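(* Let $d\geq 1$. In the sequence of maps $H_*\mathcal{B}_d^{(2)}\to H_*\mathcal{B}_d^{(3)}\to H_*\mathcal{B}_d^{(4)}\to\cdots$ induced in homology by the inclusions $\mathcal{B}_d^{(2)}\subset\mathcal{B}_d^{(3)}\subset\mathcal{B}_d^{(4)}\subset\cdots$, each map factors through the commutative operad $\mathcal{C}om$: for every $k\geq 2$ the map $H_*\mathcal{B}_d^{(k)}\to H_*\mathcal{B}_d^{(k+1)}$ equals a composite $H_*\mathcal{B}_d^{(k)}\to\mathcal{C}om\hookrightarrow H_*\mathcal{B}_d^{(k+1)}$ (in every arity $n\geq 0$).
   Context: Let $D^d\subset\mathbb{R}^d$ be the open unit disc and let $\mathcal{B}_d(1)$ be the space of maps $D^d\to D^d$ of the form $x\mapsto c+rx$ with $r>0$, identified with discs inside $D^d$. For $k\geq 2$, $n\geq 0$, $\mathcal{B}_d^{(k)}(n)\subset(\mathcal{B}_d(1))^n$ is the subspace of $n$-tuples of labeled discs such that no $k$ of the discs (with $k$ distinct labels) share a common point. Thus $\mathcal{B}_d^{(2)}=\mathcal{B}_d$ is the little $d$-discs operad and $\mathcal{B}_d^{(k)}(n)\subset\mathcal{B}_d^{(k+1)}(n)$. $H_*$ denotes singular homology with integer coefficients, taken arity by arity. $\mathcal{C}om$ is the unital commutative operad, $\mathcal{C}om(n)=\mathbb{Z}$ in degree $0$ for every $n\ge 0$, i.e. the homology of a point. For $k\geq 3$ one has $H_0\mathcal{B}_d^{(k)}=\mathcal{C}om$, and the map $\mathcal{C}om\hookrightarrow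 H_*\mathcal{B}_d^{(k)}$ is the inclusion of $H_0\mathcal{B}_d^{(k)}$. The map $H_*\mathcal{B}_d^{(k)}(n)\to\mathcal{C}om(n)$ is the one induced by the map from $\mathcal{B}_d^{(k)}(n)$ to a point: for $d\geq 2$ or $k\geq 3$ it is the projection onto $H_0\mathcal{B}_d^{(k)}=\mathcal{C}om$, and for $d=1$, $k=2$ it is the natural projection $\mathcal{A}ssoc\to\mathcal{C}om$. *)

(* Defs.v *)
From HB Require Import structures.
From mathcomp Require Import all_boot all_order all_algebra ring_quotient.
From mathcomp Require Import all_classical all_reals topology normedtype.
From mathcomp Require Import freeg.

Set Implicit Arguments.
Unset Strict Implicit.
Unset Printing Implicit Defensive.

Import Order.TTheory GRing.Theory Num.Theory.
Import numFieldNormedType.Exports.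

Local Open Scope classical_set_scope.
Local Open Scope ring_scope.
Local Open Scope quotient_scope.

HB.instance Definition _ (S : nzRingType) (K : choiceType) (M : lmodType S)
    (f : K -> M) :=
  GRing.isZmodMorphism.Build {freeg K / S} M (fglift f) (lift_is_additive f).

Section Simplices.
Context (R : realType).

Definition std_simplex (m : nat) : set 'rV[R]_m.+1 :=
  [set x | (forall i, 0 <= x 0 i) /\ \sum_i x 0 i = 1].
Arguments std_simplex : clear implicits.

Definition insert0 (m : nat) (i : 'I_m.+2) (x : 'rV[R]_m.+1) : 'rV[R]_m.+2 :=
  \row_j (if unlift i j is Some j' then x 0 j' else 0).

Lemma insert0_simplex m i (x : 'rV[R]_m.+1) :
  std_simplex m x -> std_simplex m.+1 (insert0 i x).
Proof.
move=> [x0 x1]; split=> [j|]; first by rewrite mxE; case: unliftP.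
rewrite (bigD1_ord i) //= mxE unlift_none add0r -[RHS]x1.
by apply: eq_bigr => j _; rewrite mxE liftK.
Qed.

Definition coface m (i : 'I_m.+2) (x : std_simplex m) : std_simplex m.+1 :=
  SigSub (mem_set (insert0_simplex i (set_mem (valP x)))).

Lemma continuous_coface m i : continuous (@coface m i).
Proof.
apply: continuous_comp_initial => x A [/= P xP sPA].
have cval : continuous (set_val : std_simplex m -> 'rV[R]_m.+1).
  exact: initial_continuous.
have near_x j : nbhs x [set y : std_simplex m | P 0 j (insert0 i (set_val y) 0 j)].
  have cj : continuous (fun y : std_simplex m => insert0 i (set_val y) 0 j).
    have -> : (fun y : std_simplex m => insert0 i (set_val y) 0 j) =
        (fun y => if unlift i j is Some j' then set_val y 0 j' else 0).
      by apply/funext => y; rewrite mxE.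
    case: (unlift i j) => [j'|]; last exact: cst_continuous.
    move=> y.
    apply: (@continuous_comp _ _ _ _ (fun z : 'rV[R]_m.+1 => z 0 j')).
      exact: cval.
    exact: coord_continuous.
  exact: cj x _ (xP 0 j).
apply: (@filterS _ _ _ _ _ _ (filter_forall _ near_x)) => y Py; apply: sPA => a b.
by rewrite (ord1 a); exact: Py.
Qed.

HB.instance Definition _ m i :=
  @isContinuous.Build _ _ (@coface m i) (@continuous_coface m i).

Definition simplex (m : nat) (X : topologicalType) :=
  continuousType (std_simplex m) X.
HB.instance Definition _ m X := Choice.on (simplex m X).

Definition face m X (i : 'I_m.+2) (s : simplex m.+1 X) : simplex m X :=
  s \o coface i.

Definition push_simplex m (X Y : topologicalType) (f : continuousType X Y)
  (s : simplex m X) : simplex m Y := f \o s.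

End Simplices.

Arguments std_simplex : clear implicits.

Section Homology.
Context (R : realType).

Definition chain (m : nat) (X : topologicalType) : lmodType int :=
  {freeg (simplex R m X) / int}.

Definition boundary m X : chain m.+1 X -> chain m X :=
  fglift (fun s : simplex R m.+1 X =>
    \sum_(i < m.+2) (-1) ^+ i *: << face i s >>).

HB.instance Definition _ m X :=
  GRing.isZmodMorphism.Build (chain m.+1 X) (chain m X) (@boundary m X)
    (lift_is_additive _).

Definition cycle_pred m X : {pred chain m X} :=
  match m return {pred chain m X} with
  | 0 => fun _ => true
  | p.+1 => fun c => boundary c == 0
  end.

Lemma cycle_pred_closed m X : zmod_closed (@cycle_pred m X).
Proof.
case: m => [|p]; first by split.
split=> [|a b]; first by apply/eqP; exact: raddf0.
by move=> /eqP/= ha /eqP/= hb; apply/eqP; rewrite raddfB /= ha hb subr0.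
Qed.
HB.instance Definition _ m X :=
  GRing.isZmodClosed.Build (chain m X) (@cycle_pred m X)
    (@cycle_pred_closed m X).

Record cycle m X := Cycle
  { cycle_val :> chain m X; cycleP : cycle_val \in @cycle_pred m X }.
HB.instance Definition _ m X := [isSub for @cycle_val m X].
HB.instance Definition _ m X := [Choice of cycle m X by <:].
HB.instance Definition _ m X := [SubChoice_isSubZmodule of cycle m X by <:].

Definition bounding m X : {pred cycle m X} :=
  fun c => `[< exists b : chain m.+1 X, boundary b = c >].

Lemma bounding_closed m X : zmod_closed (@bounding m X).
Proof.
split=> [|a b]; rewrite !unfold_in.
  by apply/asboolP; exists 0; rewrite raddf0.
move=> /asboolP[a' ha] /asboolP[b' hb]; apply/asboolP; exists (a' - b').
by rewrite raddfB /= ha hb.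
Qed.
HB.instance Definition _ m X :=
  GRing.isZmodClosed.Build (cycle m X) (@bounding m X) (@bounding_closed m X).

Definition homology m X : zmodType := Quotient.quot (@bounding m X).

Definition hclass m X (c : cycle m X) : homology m X :=
  \pi_(Quotient.quot (@bounding m X)) c.
HB.instance Definition _ m X :=
  GRing.isZmodMorphism.Build (cycle m X) (homology m X) (@hclass m X)
    (pi_is_zmod_morphism _).

Lemma hclass_surj m X (a : homology m X) : exists c : cycle m X, hclass c = a.
Proof. by exists (repr a); rewrite /hclass reprK. Qed.


Lemma chain_eq m X (M : zmodType) (u v : {additive chain m X -> M}) :
  (forall s, u << s >> = v << s >>) -> u =1 v.
Proof.
move=> uv c; rewrite -[c]freeg_sumE !raddf_sum; apply: eq_bigr => s _.
by rewrite -[coeff s c]intz -freegU_mulz !raddfMz uv.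
Qed.

Section Functoriality.
Context (X Y : topologicalType) (f : continuousType X Y).

Definition chain_map m : chain m X -> chain m Y :=
  fglift (fun s : simplex R m X => (<< push_simplex f s >> : chain m Y)).
HB.instance Definition _ m :=
  GRing.isZmodMorphism.Build (chain m X) (chain m Y) (@chain_map m)
    (lift_is_additive _).

Lemma boundary_chain_map m (c : chain m.+1 X) :
  boundary (chain_map c) = chain_map (boundary c).
Proof.
move: c; apply: (@chain_eq _ _ _ (@boundary m Y \o @chain_map m.+1)
  (@chain_map m \o @boundary m X)) => s /=.
rewrite /chain_map /boundary !liftU !scale1r liftU scale1r raddf_sum /=.
apply: eq_bigr => i _; rewrite raddfZsign /= liftU scale1r.
by congr (_ *: << _ >>); apply/continuousEP.
Qed.

Lemma chain_map_cycle m (c : cycle m X) : chain_map c \in @cycle_pred m Y.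
Proof.
case: m c => [|m] [c /eqP/= dc]; first by [].
by apply/eqP; rewrite boundary_chain_map dc raddf0.
Qed.

Definition cycle_map m (c : cycle m X) : cycle m Y := Cycle (chain_map_cycle c).

Lemma cycle_map_is_zmod_morphism m : zmod_morphism (@cycle_map m).
Proof. by move=> a b; apply: val_inj; rewrite /= !raddfB. Qed.
HB.instance Definition _ m :=
  GRing.isZmodMorphism.Build (cycle m X) (cycle m Y) (@cycle_map m)
    (@cycle_map_is_zmod_morphism m).

Definition homology_map m (a : homology m X) : homology m Y :=
  hclass (cycle_map (repr a)).

Lemma homology_map_hclass m (c : cycle m X) :
  homology_map (hclass c) = hclass (cycle_map c).
Proof.
apply/eqP; rewrite /homology_map -Quotient.idealrBE -raddfB.
have : repr (hclass c) - c \in @bounding m X.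
  by rewrite Quotient.idealrBE reprK.
rewrite !unfold_in => /asboolP[b hb]; apply/asboolP; exists (chain_map b).
by rewrite boundary_chain_map hb.
Qed.

Lemma homology_map_is_zmod_morphism m : zmod_morphism (@homology_map m).
Proof.
move=> a b; have [c <-] := hclass_surj a; have [e <-] := hclass_surj b.
by rewrite -raddfB !homology_map_hclass !raddfB.
Qed.
HB.instance Definition _ m :=
  GRing.isZmodMorphism.Build (homology m X) (homology m Y) (@homology_map m)
    (@homology_map_is_zmod_morphism m).

End Functoriality.

Section Augmentation.
Context (X : topologicalType).

(* On [H_0], the class of [\sum_s a_s s] is sent to [\sum_s a_s]. *)
Definition augmentation (a : homology 0 X) : int := deg (repr a : chain 0 X).

Lemma deg_boundary (b : chain 1 X) : deg (boundary b) = 0.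
Proof.
move: b; apply: (@chain_eq _ _ _ (@deg _ \o @boundary 0 X) \0) => s /=.
rewrite /boundary liftU scale1r raddf_sum /= !big_ord_recl big_ord0 /=.
by rewrite expr0 scale1r expr1 scaleN1r degN !degU addr0 subrr.
Qed.

Lemma augmentation_hclass (c : cycle 0 X) :
  augmentation (hclass c) = deg (c : chain 0 X).
Proof.
apply/eqP; rewrite -subr_eq0 -degB.
have : repr (hclass c) - c \in @bounding 0 X.
  by rewrite Quotient.idealrBE reprK.
by rewrite unfold_in => /asboolP[b /= <-]; rewrite deg_boundary.
Qed.

Lemma augmentation_is_zmod_morphism : zmod_morphism augmentation.
Proof.
move=> a b; have [c <-] := hclass_surj a; have [e <-] := hclass_surj b.
by rewrite -raddfB !augmentation_hclass raddfB.
Qed.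
HB.instance Definition _ :=
  GRing.isZmodMorphism.Build (homology 0 X) int augmentation
    augmentation_is_zmod_morphism.

End Augmentation.

(* [com n m] is the degree [m] part of the arity [n] component; ['I_1] is the
   trivial group. *)
Definition com (n m : nat) : zmodType := if m is 0 then int else 'I_1.

Definition point : topologicalType := discrete_topology unit.

Definition com_of_point n m : homology m point -> com n m :=
  match m return homology m point -> com n m with
  | 0 => @augmentation point
  | _.+1 => fun _ => 0
  end.

Lemma com_of_point_is_zmod_morphism n m : zmod_morphism (@com_of_point n m).
Proof. by case: m => [|m] a b /=; rewrite ?raddfB ?subr0. Qed.
HB.instance Definition _ n m :=
  GRing.isZmodMorphism.Build (homology m point) (com n m) (@com_of_point n m)
    (@com_of_point_is_zmod_morphism n m).

Definition point_simplex m : simplex R m point :=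
  cst tt : continuousType (std_simplex R m) point.

Lemma chain_point m (c : chain m point) : c = deg c *: << point_simplex m >>.
Proof.
have -> : deg c = \sum_(s <- dom c) coeff s c.
  rewrite -{1}[c]freeg_sumE (raddf_sum (@deg _)).
  by apply: eq_bigr => s _; exact: degU.
rewrite -{1}[c]freeg_sumE scaler_suml; apply: eq_bigr => s _.
have -> : s = point_simplex m by apply/continuousEP => x; case: (s x).
by rewrite -[X in << X *g _ >>]intz -freegU_mulz -scaler_int intz.
Qed.

Lemma boundary_point m :
  boundary << point_simplex m.+1 >> = (odd m)%:R *: << point_simplex m >>.
Proof.
rewrite /boundary liftU scale1r.
have -> : \sum_(i < m.+2) (-1) ^+ i *: << face i (point_simplex m.+1) >> =
    (\sum_(i < m.+2) (-1) ^+ i : int) *: (<< point_simplex m >> : chain m point).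
  rewrite scaler_suml; apply: eq_bigr => i _.
  by congr (_ *: << _ >>); apply/continuousEP.
suff -> j : \sum_(i < j) (-1) ^+ i = (odd j)%:R :> int by rewrite /= negbK.
elim: j => [|j IHj]; first by rewrite big_ord0.
by rewrite big_ord_recr /= IHj -signr_odd; case: (odd j).
Qed.

Lemma com_of_point_bij n m : bijective (@com_of_point n m).
Proof.
suff [inj surj] : injective (@com_of_point n m) /\
    forall z, exists a, @com_of_point n m a = z.
  have [g gK] := choice surj.
  by exists g => [a|]; [apply: inj; rewrite gK|].
case: m => [|m]; split.
- apply: raddf_inj => a; have [c <-] := hclass_surj a.
  rewrite /= augmentation_hclass => c0; have -> : c = 0; last exact: raddf0.
  by apply: val_inj; rewrite /= [cycle_val c]chain_point c0 scale0r.
- move=> z; have hz : z *: << point_simplex 0 >> \in @cycle_pred 0 point by [].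
  exists (hclass (Cycle hz)); rewrite /= augmentation_hclass /=.
  by rewrite -[z]intz scaler_int freegU_mulz degU.
- apply: raddf_inj => a _; have [c <-] := hclass_surj a.
  apply/eqP; rewrite -(raddf0 (@hclass m.+1 point)) -Quotient.idealrBE subr0.
  have := cycleP c; rewrite unfold_in /= {1}[cycle_val c]chain_point.
  rewrite -[deg _]intz scaler_int raddfMz /= boundary_point => /eqP dc.
  rewrite unfold_in; apply/asboolP.
  exists (deg (c : chain m.+1 point) *: << point_simplex m.+2 >>).
  rewrite [RHS]chain_point -[deg _]intz !scaler_int raddfMz /= boundary_point /=.
  case: (odd m) dc => [/(congr1 (@deg _))|_]; last by rewrite scale1r.
  by rewrite scale1r freegU_mulz degU intz deg0 => ->; rewrite !mulr0z.
- by move=> z; exists 0; rewrite [z]ord1.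
Qed.

(* Induced by the map from [X] to a point, whose homology is [com n] by
   [com_of_point_bij]. *)
Definition to_com n m (X : topologicalType) (a : homology m X) : com n m :=
  com_of_point n (homology_map (cst tt : continuousType X point) a).

End Homology.

Section NonOverlappingDiscs.
Context (R : realType) (d : nat).

(* Open Euclidean unit disc; the library norm on ['rV[R]_d] is the sup norm. *)
Definition unit_disc : set 'rV[R]_d := [set x | \sum_i x 0 i ^+ 2 < 1].

(* The pair [(c, r)] stands for the map [x |-> c + r x]. *)
Definition little_discs : set ('rV[R]_d * R) :=
  [set D | 0 < D.2 /\ forall x, unit_disc x -> unit_disc (D.1 + D.2 *: x)].

Definition disc (D : little_discs) : set 'rV[R]_d :=
  [set (val D).1 + (val D).2 *: x | x in unit_disc].

Definition nonoverlapping (k n : nat) : set {ptws 'I_n -> little_discs} :=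
  [set D | forall J : {set 'I_n}, #|J| = k ->
     ~ exists p, forall i, i \in J -> disc (D i) p].
Arguments nonoverlapping : clear implicits.

Definition discs_space (k n : nat) : topologicalType :=
  set_type (nonoverlapping k n).

Lemma nonoverlappingS k n : nonoverlapping k n `<=` nonoverlapping k.+1 n.
Proof.
move=> D Dk J cardJ [p Jp].
have [i iJ] : exists i, i \in J by apply/card_gt0P; rewrite cardJ.
apply: (Dk (J :\ i)%SET); first by move: (cardsD1 i J); rewrite iJ cardJ => -[].
by exists p => j; rewrite finset.in_setD1 => /andP[_]; exact: Jp.
Qed.

Definition discs_incl k n (D : discs_space k n) : discs_space k.+1 n :=
  SigSub (mem_set (nonoverlappingS (set_mem (valP D)))).

Lemma continuous_discs_incl k n : continuous (@discs_incl k n).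
Proof. apply: continuous_comp_initial; exact: initial_continuous. Qed.
HB.instance Definition _ k n :=
  isContinuous.Build _ _ (@discs_incl k n) (@continuous_discs_incl k n).

End NonOverlappingDiscs.

Arguments discs_space : clear implicits.
Arguments discs_incl : clear implicits.

(* Main.v *)
(* The inclusion of B^(k)(n) into B^(k+1)(n) is null-homotopic: scale the
   configuration into the disc of radius 1/2, then move its discs one after the
   other along straight lines to pairwise disjoint slots lying in the half-space
   x_0 > 1/2. The discs at rest have no k-fold point off the slots, and the slots
   are disjoint, so the moving disc creates at most k-fold points. Every point of
   B^(k+1)(n) is joined to one of B^(k)(n) by shrinking its discs inside
   themselves to pairwise disjoint ones, hence B^(k+1)(n) is path-connected. *)

Require Import Defs.
From mathcomp Require Import freeg.
From HB Require Import structures.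
From mathcomp Require Import all_boot all_order all_algebra.
From mathcomp Require Import all_classical all_reals topology normedtype.
From mathcomp Require Import zify ring lra.

Set Implicit Arguments.
Unset Strict Implicit.
Unset Printing Implicit Defensive.

Import Order.TTheory GRing.Theory Num.Theory.
Import numFieldNormedType.Exports.

Local Open Scope classical_set_scope.
Local Open Scope ring_scope.

(** * Continuity criteria and affine maps between standard simplices *)

Lemma continuous_compose (X Y Z : topologicalType) (f : X -> Y) (g : Y -> Z) :
  continuous f -> continuous g -> continuous (g \o f).
Proof. by move=> cf cg x; apply: continuous_comp; [exact: cf|exact: cg]. Qed.

Lemma continuous_pair (X Y Z : topologicalType) (f : X -> Y) (g : X -> Z) :
  continuous f -> continuous g -> continuous (fun x => (f x, g x)).
Proof. by move=> cf cg x; exact: cvg_pair (cf x) (cg x). Qed.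

Section SimplexMaps.
Context (R : realType).

Lemma continuous_to_rV (T : topologicalType) n (f : T -> 'rV[R]_n) :
  (forall j, continuous (fun x => f x 0 j)) -> continuous f.
Proof.
move=> cf x A [/= P xP sPA].
have near_x j : nbhs x [set y | P 0 j (f y 0 j)] by exact: cf x _ (xP 0 j).
apply: (@filterS _ _ _ _ _ _ (filter_forall _ near_x)) => y Py; apply: sPA.
by move=> a b; rewrite (ord1 a); exact: Py.
Qed.

Lemma continuous_val (T : topologicalType) (A : set T) :
  continuous (set_val : A -> T).
Proof. exact: initial_continuous. Qed.

Lemma continuous_coord (m : nat) (j : 'I_m.+1) :
  continuous (fun x : std_simplex R m => set_val x 0 j).
Proof.
move=> x.
apply: (@continuous_comp _ _ _ set_val (fun z : 'rV[R]_m.+1 => z 0 j)).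
  exact: continuous_val.
exact: coord_continuous.
Qed.

(** The affine map sending vertex [l] to vertex [f l], in barycentric coordinates. *)
Definition simplicial a b (f : 'I_a.+1 -> 'I_b.+1) (x : 'rV[R]_a.+1) :
  'rV[R]_b.+1 := \row_j \sum_(l | f l == j) x 0 l.

Lemma simplicial_simplex a b (f : 'I_a.+1 -> 'I_b.+1) x :
  std_simplex R a x -> std_simplex R b (simplicial f x).
Proof.
move=> [x0 x1]; split=> [j|]; first by rewrite mxE; apply: sumr_ge0 => l _.
rewrite -x1 (partition_big f xpredT) //=.
by apply: eq_bigr => j _; rewrite mxE.
Qed.

Definition simplex_map a b (f : 'I_a.+1 -> 'I_b.+1) (x : std_simplex R a) :
  std_simplex R b := SigSub (mem_set (simplicial_simplex f (set_mem (valP x)))).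

Lemma continuous_simplex_map a b f : continuous (@simplex_map a b f).
Proof.
apply: continuous_comp_initial; apply: continuous_to_rV => j.
rewrite (_ : (fun _ => _) =
  (fun x : std_simplex R a => \sum_(l | f l == j) set_val x 0 l)).
  apply: continuous_big => [|l _]; last exact: continuous_coord.
  exact: add_continuous.
by apply/funext => x; rewrite mxE.
Qed.

Lemma simplex_map_comp a b c (g : 'I_b.+1 -> 'I_c.+1)
    (f : 'I_a.+1 -> 'I_b.+1) x :
  simplex_map g (simplex_map f x) = simplex_map (g \o f) x.
Proof.
apply: val_inj; apply/rowP => j; rewrite !mxE.
rewrite (partition_big f (fun k => g k == j)) //=.
apply: eq_bigr => k /eqP gk; rewrite mxE; apply: eq_bigl => l.
by case: eqP => [->|]; rewrite ?andbF // gk eqxx.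
Qed.

Lemma simplex_map_id a x : simplex_map (@id 'I_a.+1) x = x.
Proof.
apply: val_inj; apply/rowP => j; rewrite !mxE.
by rewrite (big_pred1 j).
Qed.

(** With cofaces written as vertex maps, face identities reduce to identities between functions on
    indices. *)
Lemma coface_simplex_map m (i : 'I_m.+2) (x : std_simplex R m) :
  coface i x = simplex_map (lift i) x.
Proof.
apply: val_inj; apply/rowP => j; rewrite !mxE.
case: unliftP => [l|] ->.
  by rewrite (big_pred1 l) // => k; rewrite (inj_eq lift_inj).
by rewrite big_pred0 // => k; rewrite eq_sym (negbTE (neq_lift _ _)).
Qed.

End SimplexMaps.

(** * The prism operator and homotopy invariance *)

Section ProductSimplices.
Context (R : realType) (X Y : topologicalType).
Context (H : continuousType (X * std_simplex R 1)%type Y).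

Lemma continuous_prod_simplex m a (s : simplex R m X)
    (f : 'I_a.+1 -> 'I_m.+1) (h : 'I_a.+1 -> 'I_2) :
  continuous (fun x : std_simplex R a =>
    H (s (simplex_map f x), simplex_map h x)).
Proof.
apply: (@continuous_compose _ (X * std_simplex R 1)%type _
  (fun x => (s (simplex_map f x), simplex_map h x)) H); last exact: cts_fun.
apply: continuous_pair; last exact: continuous_simplex_map.
apply: (@continuous_compose _ _ _ (simplex_map f) s); last exact: cts_fun.
exact: continuous_simplex_map.
Qed.

(** The interval is modelled by the 1-simplex, so a simplex of the prism is given by two vertex
    maps: [f] into the domain of [s] and [h] into the interval. *)
Definition prod_simplex m a (s : simplex R m X)
    (f : 'I_a.+1 -> 'I_m.+1) (h : 'I_a.+1 -> 'I_2) : simplex R a Y :=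
  mkcts (@continuous_prod_simplex m a s f h).

Lemma eq_prod_simplex m a (s : simplex R m X) (f f' : 'I_a.+1 -> 'I_m.+1)
    (h h' : 'I_a.+1 -> 'I_2) :
  f =1 f' -> h =1 h' -> prod_simplex s f h = prod_simplex s f' h'.
Proof. by move=> /funext -> /funext ->. Qed.

Lemma face_prod_simplex m a (s : simplex R m X) (f : 'I_a.+2 -> 'I_m.+1)
    (h : 'I_a.+2 -> 'I_2) j :
  face j (prod_simplex s f h) = prod_simplex s (f \o lift j) (h \o lift j).
Proof.
apply/continuousEP => x; rewrite /= /mkcts.
by rewrite coface_simplex_map !simplex_map_comp.
Qed.

Lemma prod_simplex_face m a (s : simplex R m.+1 X) (f : 'I_a.+1 -> 'I_m.+1)
    (h : 'I_a.+1 -> 'I_2) j :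
  prod_simplex (face j s) f h = prod_simplex s (lift j \o f) h.
Proof.
apply/continuousEP => x; rewrite /= /mkcts /=.
by rewrite coface_simplex_map !simplex_map_comp.
Qed.

(* The [i]-th simplex of the prism has vertices
   [(v_0, 0), .., (v_i, 0), (v_i, 1), .., (v_m, 1)]. *)
Definition prism_simplex m (s : simplex R m X) i : simplex R m.+1 Y :=
  prod_simplex s (fun l : 'I_m.+2 => inord (unbump i l))
    (fun l : 'I_m.+2 => inord (i < l)%N).

Definition prism m : chain R m X -> chain R m.+1 Y :=
  fglift (fun s : simplex R m X =>
    \sum_(i < m.+1) (-1) ^+ i *: (<< prism_simplex s i >> : chain R m.+1 Y)).
HB.instance Definition _ m :=
  GRing.isZmodMorphism.Build (chain R m X) (chain R m.+1 Y) (@prism m)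
    (lift_is_additive _).

(** The sign bookkeeping of the prism formula, on natural indices to avoid dependent ordinals. Here
    [A i j] stands for face [j] of prism simplex [i], [B i j] for prism simplex [i] over face [j],
    and [Q i] for the inner walls. The faces [j = i] and [j = i + 1] telescope; all others cancel
    against the second double sum. *)
Lemma prism_sum (V : lmodType int) m (A B : nat -> nat -> V) (Q : nat -> V) :
  (forall i j, j < i <= m -> A i j = B i.-1 j)%N ->
  (forall i, i <= m -> A i i = Q i)%N ->
  (forall i, i <= m -> A i i.+1 = Q i.+1)%N ->
  (forall i j, i.+1 < j <= m.+1 -> A i j = B i j.-1)%N ->
  \sum_(i < m.+1) (-1) ^+ i *: (\sum_(j < m.+2) (-1) ^+ j *: A i j) +
  \sum_(j < m.+1) (-1) ^+ j *: (\sum_(i < m) (-1) ^+ i *: B i j) =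
  Q 0 - Q m.+1.
Proof.
move=> Alt Aeq AeqS Agt.
have split_inner (i : 'I_m.+1) :
    (-1) ^+ i *: \sum_(j < m.+2) (-1) ^+ j *: A i j =
    (\sum_(0 <= j < i) (-1) ^+ (i + j) *: B i.-1 j - (Q i.+1 - Q i)) +
    \sum_(i.+2 <= j < m.+2) (-1) ^+ (i + j) *: B i j.-1.
  have im : (i <= m)%N by rewrite -ltnS.
  rewrite -(big_mkord xpredT (fun j => (-1) ^+ j *: A i j)) scaler_sumr.
  rewrite (@big_cat_nat _ _ _ i) //=; last by lia.
  rewrite (@big_cat_nat _ _ _ i.+2 i) //=; last by lia.
  rewrite !addrA; congr (_ + _ + _).
  - apply: eq_big_nat => j /andP[_ ji]; rewrite Alt ?ji //.
    by rewrite scalerA exprD.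
  - rewrite big_ltn // big_nat1 Aeq // AeqS // !scalerA -!exprD opprB.
    rewrite addnS exprS addnn -mul2n exprM sqrrN !expr1n mulr1.
    by rewrite scale1r scaleN1r.
  - apply: eq_big_nat => j /andP[ij jm]; rewrite Agt ?ij //.
    by rewrite scalerA exprD.
rewrite (eq_bigr _ (fun i _ => split_inner i)) !big_split /=.
rewrite sumrN -(big_mkord xpredT (fun i => Q i.+1 - Q i)) telescope_sumr //.
rewrite opprB !(addrAC _ (Q 0%N - Q m.+1)) -[RHS]add0r; congr (_ + _).
under [X in _ + X]eq_bigr do rewrite scaler_sumr.
(* For [i = 0] no [j] lies below [i], and for [i = m] none lies above [i + 1]. Dropping these empty
   sums leaves three sums over [i < m]. For each [i] the third, split at [j = i + 1], cancels the
   other two. *)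
rewrite exchange_big /= big_ord_recl big_geq // add0r.
rewrite [X in _ + X + _]big_ord_recr /= [X in _ + (_ + X)]big_geq // addr0.
rewrite -!big_split big1 //= => i _.
have im := ltn_ord i.
rewrite big_add1 /=.
rewrite -(big_mkord xpredT (fun j => (-1) ^+ j *: ((-1) ^+ i *: B i j))).
rewrite [X in _ + X](@big_cat_nat _ _ _ i.+1) //=; last by lia.
rewrite addrACA -!big_split /= !big1 ?addr0 // => j _.
  by rewrite addnS scalerA -exprD addnC exprS mulN1r scaleNr addNr.
by rewrite /bump /= add1n addSn scalerA -exprD addnC exprS mulN1r scaleNr addNr.
Qed.


Lemma eq_freegU (T : choiceType) (x y : T) :
  x = y -> << x >> = << y >> :> {freeg T / int}.
Proof. by move->. Qed.

(** The second summand is the prism of the boundary of [s], written on the vertices of [s] so that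
    it also makes sense for [m = 0], where no boundary is defined. *)
Lemma boundary_prism_simplex m (s : simplex R m X) :
  boundary (prism << s >>) +
    \sum_(j < m.+1) (-1) ^+ j *: (\sum_(i < m) (-1) ^+ i *:
      (<< prod_simplex s (fun l : 'I_m.+1 => inord (bump j (unbump i l)))
         (fun l : 'I_m.+1 => inord (i < l)%N) >> : chain R m Y)) =
  << prod_simplex s id (fun=> ord_max) >> - << prod_simplex s id (fun=> ord0) >>.
Proof.
pose A i j : chain R m Y :=
  << prod_simplex s (fun l : 'I_m.+1 => inord (unbump i (bump j l)))
       (fun l : 'I_m.+1 => inord (i < bump j l)%N) >>.
pose B i j : chain R m Y :=
  << prod_simplex s (fun l : 'I_m.+1 => inord (bump j (unbump i l)))
       (fun l : 'I_m.+1 => inord (i < l)%N) >>.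
(* The wall between prism simplices [i - 1] and [i]: vertices before [i] lie at the start of the
   homotopy, the others at its end. The extreme walls are the two ends of the prism. *)
pose Q i : chain R m Y :=
  << prod_simplex s id (fun l : 'I_m.+1 => inord (i <= l)%N) >>.
have -> : << prod_simplex s id (fun=> ord_max) >> = Q 0%N.
  by apply/eq_freegU/eq_prod_simplex => // l; apply: val_inj; rewrite /= inordK.
have -> : << prod_simplex s id (fun=> ord0) >> = Q m.+1.
  apply/eq_freegU/eq_prod_simplex => // l; apply: val_inj; rewrite /= inordK //.
    by rewrite leqNgt ltn_ord.
  by rewrite ltnS leq_b1.
rewrite -(@prism_sum _ m A B Q); first last.
- move=> i j /andP[ij jm]; apply/eq_freegU/eq_prod_simplex => l;
    congr inord; have := ltn_ord l; rewrite /bump /unbump; lia.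
- move=> i im; apply/eq_freegU/eq_prod_simplex => l; last first.
    by congr inord; have := ltn_ord l; rewrite /bump /unbump; lia.
  by apply: val_inj; rewrite /= inordK; have := ltn_ord l;
    rewrite /bump /unbump; lia.
- move=> i im; apply/eq_freegU/eq_prod_simplex => l; last first.
    by congr inord; have := ltn_ord l; rewrite /bump /unbump; lia.
  by apply: val_inj; rewrite /= inordK; have := ltn_ord l;
    rewrite /bump /unbump; lia.
- move=> i j /andP[ij jm]; apply/eq_freegU/eq_prod_simplex => l;
    congr inord; have := ltn_ord l; rewrite /bump /unbump; lia.
congr (_ + _).
rewrite /prism liftU scale1r raddf_sum /=; apply: eq_bigr => i _.
rewrite raddfZsign /=; congr (_ *: _).
rewrite /boundary liftU scale1r; apply: eq_bigr => j _; congr (_ *: _).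
apply: eq_freegU; rewrite face_prod_simplex; exact: eq_prod_simplex.
Qed.

End ProductSimplices.

Section HomotopyInvariance.
Context (R : realType) (X Y : topologicalType) (f g : continuousType X Y).
Context (H : continuousType (X * std_simplex R 1)%type Y).
(** Each end of the interval is described by the vanishing of the opposite barycentric coordinate,
    which is what a constant vertex map yields. *)
Hypothesis Hf : forall x (t : std_simplex R 1),
  set_val t 0 ord_max = 0 -> H (x, t) = f x.
Hypothesis Hg : forall x (t : std_simplex R 1),
  set_val t 0 ord0 = 0 -> H (x, t) = g x.

Lemma prod_simplex_start m (s : simplex R m X) :
  prod_simplex H s id (fun=> ord0) = push_simplex f s.
Proof.
apply/continuousEP => x; rewrite /= /mkcts Hf; last by rewrite mxE big_pred0.
by rewrite simplex_map_id.
Qed.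

Lemma prod_simplex_end m (s : simplex R m X) :
  prod_simplex H s id (fun=> ord_max) = push_simplex g s.
Proof.
apply/continuousEP => x; rewrite /= /mkcts Hg; last by rewrite mxE big_pred0.
by rewrite simplex_map_id.
Qed.

Lemma boundary_prism0 (c : chain R 0 X) :
  boundary (prism H c) = chain_map g c - chain_map f c.
Proof.
move: c; apply: (@chain_eq _ _ _ _ (@boundary R 0 Y \o @prism R X Y H 0)
  (@chain_map R X Y g 0 \- @chain_map R X Y f 0)) => s /=.
have := boundary_prism_simplex H s.
rewrite big1 ?addr0; last by move=> j _; rewrite big_ord0 scaler0.
move=> ->.
by rewrite /chain_map !liftU !scale1r prod_simplex_start prod_simplex_end.
Qed.

Lemma boundary_prism m (c : chain R m.+1 X) :
  boundary (prism H c) + prism H (boundary c) = chain_map g c - chain_map f c.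
Proof.
move: c; apply: (@chain_eq _ _ _ _
  ((@boundary R m.+1 Y \o @prism R X Y H m.+1) \+
   (@prism R X Y H m \o @boundary R m X))
  (@chain_map R X Y g m.+1 \- @chain_map R X Y f m.+1)) => s /=.
rewrite /chain_map !liftU !scale1r -prod_simplex_start -prod_simplex_end.
rewrite -boundary_prism_simplex; congr (_ + _).
rewrite /boundary liftU scale1r raddf_sum /=; apply: eq_bigr => j _.
rewrite raddfZsign /= /prism liftU scale1r; congr (_ *: _).
apply: eq_bigr => i _; congr (_ *: _); apply: eq_freegU.
rewrite /prism_simplex prod_simplex_face; apply: eq_prod_simplex => l //=.
apply: val_inj; rewrite /= !inordK //; have := ltn_ord l; have := ltn_ord i;
  rewrite /unbump /bump; lia.
Qed.

(** On a cycle the term [prism H (boundary c)] vanishes, or is absent in degree 0, so [prism H c]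
    bounds the difference of the two images. *)
Lemma homotopy_homology_map m (a : homology R m X) :
  homology_map f a = homology_map g a.
Proof.
have [c <-] := hclass_surj a; rewrite !homology_map_hclass.
apply/esym/eqP; rewrite -Quotient.idealrBE unfold_in; apply/asboolP.
case: m a c => [|m] a c; first by exists (prism H c); rewrite boundary_prism0.
exists (prism H c); have := boundary_prism c.
by have := cycleP c; rewrite unfold_in /= => /eqP ->; rewrite raddf0 addr0.
Qed.

End HomotopyInvariance.

(** * Maps factoring through a point *)

Section Factorization.
Context (R : realType).
Local Notation point := Defs.point.

Lemma eq_homology_map (X Y : topologicalType) (f g : continuousType X Y) m
  (a : homology R m X) : f =1 g -> homology_map f a = homology_map g a.
Proof. by move/continuousEP->. Qed.

Lemma homology_map_comp (X Y Z : topologicalType) (f : continuousType X Y)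
    (g : continuousType Y Z) m (a : homology R m X) :
  homology_map (g \o f : continuousType X Z) a =
  homology_map g (homology_map f a).
Proof.
have [c <-] := hclass_surj a; rewrite !homology_map_hclass; congr hclass.
apply: val_inj => /=; move: (cycle_val c).
apply: (@chain_eq _ _ _ _ (@chain_map R X Z (g \o f) m)
  (@chain_map R Y Z g m \o @chain_map R X Y f m)) => s /=.
rewrite /chain_map !liftU !scale1r liftU scale1r; apply: eq_freegU.
exact/continuousEP.
Qed.

Lemma com_of_point_inv n m :
  exists g : com n m -> homology R m point,
    cancel g (@com_of_point R n m) /\ cancel (@com_of_point R n m) g.
Proof. by have [g gK Kg] := com_of_point_bij R n m; exists g. Qed.

(** A chosen inverse: [com_of_point_bij] only asserts that one exists. *)
Definition com_to_point n m : com n m -> homology R m point :=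
  sval (cid (com_of_point_inv n m)).

Lemma com_to_pointK n m : cancel (@com_to_point n m) (@com_of_point R n m).
Proof. exact: (svalP (cid (com_of_point_inv n m))).1. Qed.

Lemma com_of_pointK n m : cancel (@com_of_point R n m) (@com_to_point n m).
Proof. exact: (svalP (cid (com_of_point_inv n m))).2. Qed.

(** The inclusion of the point [y] in homology, with the homology of a point replaced by [com]. At
    the base configuration it is the map [iota] of the theorem. *)
Definition com_at (Y : topologicalType) (y : Y) n m (z : com n m) :
  homology R m Y :=
  homology_map (cst y : continuousType point Y) (com_to_point z).

Lemma com_at_is_zmod_morphism (Y : topologicalType) (y : Y) n m :
  zmod_morphism (@com_at Y y n m).
Proof.
move=> a b; rewrite /com_at.
have -> : com_to_point (a - b) = com_to_point a - com_to_point b.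
  by apply: (can_inj (@com_of_pointK n m)); rewrite raddfB /= !com_to_pointK.
exact: raddfB.
Qed.
HB.instance Definition _ (Y : topologicalType) (y : Y) n m :=
  GRing.isZmodMorphism.Build (com n m) (homology R m Y) (@com_at Y y n m)
    (@com_at_is_zmod_morphism Y y n m).

(** The composite of [X -> point] and [point -> Y] is constant; hence a map that agrees in homology
    with a constant one factors through [com]. *)
Lemma com_at_to_com (X Y : topologicalType) (y : Y) n m (a : homology R m X) :
  com_at y (to_com n a) = homology_map (cst y : continuousType X Y) a.
Proof.
rewrite /com_at /to_com com_of_pointK -homology_map_comp.
exact: eq_homology_map.
Qed.

(** A chain on a point is determined by its degree, which chain maps preserve. *)
Lemma homology_map_point m (f : continuousType point point)
    (a : homology R m point) :
  homology_map f a = a.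
Proof.
have [c <-] := hclass_surj a; rewrite homology_map_hclass; congr hclass.
apply: val_inj => /=; rewrite [LHS]chain_point [RHS]chain_point; congr (_ *: _).
move: (cycle_val c).
apply: (@chain_eq _ _ _ _ (@deg _ \o @chain_map R point point f m) (@deg _)).
move=> s /=.
by rewrite /chain_map liftU scale1r !degU.
Qed.

Lemma com_atK (Y : topologicalType) (y : Y) n m :
  cancel (@com_at Y y n m) (@to_com R n m Y).
Proof.
move=> z; rewrite /to_com /com_at -homology_map_comp homology_map_point.
exact: com_to_pointK.
Qed.

(** Every 0-chain is a cycle, so classes of degree 0 form an additive function of the chain and can
    be compared on single simplices. *)
Definition class0 (X : topologicalType) (c : chain R 0 X) : homology R 0 X :=
  hclass (@Cycle R 0 X c isT).

Lemma class0_is_zmod_morphism X : zmod_morphism (@class0 X).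
Proof. by move=> a b; rewrite /class0 -raddfB; congr hclass; apply: val_inj. Qed.
HB.instance Definition _ (X : topologicalType) :=
  GRing.isZmodMorphism.Build (chain R 0 X) (homology R 0 X) (@class0 X)
    (@class0_is_zmod_morphism X).

Lemma hclass0 (X : topologicalType) (c : Defs.cycle R 0 X) :
  hclass c = class0 (cycle_val c).
Proof. by congr hclass; apply: val_inj. Qed.

Lemma homology_map_class0 (X Y : topologicalType) (f : continuousType X Y) s :
  homology_map f (class0 << s >>) = class0 << push_simplex f s >>.
Proof.
by rewrite homology_map_hclass hclass0 /= /chain_map liftU scale1r.
Qed.

Lemma std_simplex0_eq (x y : std_simplex R 0) : x = y.
Proof.
apply: val_inj; apply/rowP => j; rewrite (ord1 j).
have [_] := set_mem (valP x); have [_] := set_mem (valP y).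
by rewrite !big_ord1 => -> ->.
Qed.

Lemma simplex0_cst (X : topologicalType) (s : simplex R 0 X) :
  exists x,
    s = push_simplex (cst x : continuousType point X) (@point_simplex R 0).
Proof.
have e0P : std_simplex R 0 (const_mx 1).
  by split=> [i|]; rewrite ?big_ord1 mxE.
exists (s (SigSub (mem_set e0P))); apply/continuousEP => x /=.
by congr (s _); exact: std_simplex0_eq.
Qed.

(** The hypothesis is the homological form of path-connectedness. Classes of 0-simplices generate
    degree 0, and each comes from the inclusion of a point. *)
Lemma to_comK (Y : topologicalType) (y0 : Y) n :
  (forall (y : Y) (a : homology R 0 point),
    homology_map (cst y : continuousType point Y) a =
    homology_map (cst y0 : continuousType point Y) a) ->
  cancel (@to_com R n 0 Y) (@com_at Y y0 n 0).
Proof.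
move=> y0P a; rewrite com_at_to_com.
have [c <-] := hclass_surj a; rewrite homology_map_hclass !hclass0 /=.
move: (cycle_val c).
apply: (@chain_eq _ _ _ _ (@class0 Y \o chain_map (cst y0) (m := 0))
  (@class0 Y)).
move=> s /=; have [y ->] := simplex0_cst s.
rewrite -homology_map_class0 y0P homology_map_class0 /chain_map liftU scale1r.
by congr class0; apply: eq_freegU; apply/continuousEP.
Qed.

End Factorization.

(** * Straight-line homotopies of discs *)

Section MovingDiscs.
Context (R : realType) (d : nat).
Local Notation unit_disc := (@unit_disc R d).
Local Notation little_discs := (@little_discs R d).

Lemma unit_disc_convex x y s t : 0 <= s -> 0 <= t -> s + t = 1 ->
  unit_disc x -> unit_disc y -> unit_disc (s *: x + t *: y).
Proof.
rewrite /Defs.unit_disc /= => s0 t0 st1 x1 y1.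
apply: (@le_lt_trans _ _ (s * (\sum_i x 0 i ^+ 2) + t * (\sum_i y 0 i ^+ 2))).
  rewrite !mulr_sumr -big_split /=; apply: ler_sum => i _; rewrite !mxE.
  have -> : t = 1 - s by rewrite -st1 addrC addKr.
  (* For [s + t = 1], the difference of the two sides is [s t (x_i - y_i)^2]. *)
  have : 0 <= s * (1 - s) * (x 0 i - y 0 i) ^+ 2.
    by rewrite mulr_ge0 ?sqr_ge0 // mulr_ge0 //; lra.
  by lra.
have [s_eq0|s_neq0] := eqVneq s 0; first by move: st1 y1; rewrite s_eq0; nra.
have s_gt0 : 0 < s by rewrite lt_neqAle eq_sym s_neq0.
by nra.
Qed.

Lemma unit_disc_coord x i : unit_disc x -> -1 < x 0 i < 1.
Proof.
rewrite /Defs.unit_disc /= (bigD1 i) //= => x1.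
have : 0 <= \sum_(j < d | j != i) x 0 j ^+ 2.
  by apply: sumr_ge0 => j _; exact: sqr_ge0.
by nra.
Qed.

Lemma std_simplex1P (t : std_simplex R 1) :
  [/\ 0 <= set_val t 0 ord0, 0 <= set_val t 0 ord_max &
      set_val t 0 ord0 + set_val t 0 ord_max = 1].
Proof.
have [t0 t1] := set_mem (valP t); split; [exact: t0|exact: t0|].
by rewrite -t1 big_ord_recl big_ord1; congr (_ + set_val t 0 _); apply: val_inj.
Qed.

Lemma little_discs_radius (D : little_discs) : 0 < (val D).2.
Proof. by have [] := set_mem (valP D). Qed.

Lemma disc_unit_disc (D : little_discs) p : disc D p -> unit_disc p.
Proof. by have [_ D1] := set_mem (valP D); move=> [x /D1 x1 <-]. Qed.

Lemma disc_convex (D : little_discs) p q s t : 0 <= s -> 0 <= t -> s + t = 1 ->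
  disc D p -> disc D q -> disc D (s *: p + t *: q).
Proof.
move=> s0 t0 st1 [x x1 <-] [y y1 <-]; exists (s *: x + t *: y).
  exact: unit_disc_convex.
rewrite !scalerDr addrACA -scalerDl st1 scale1r !scalerA.
by rewrite (mulrC s) (mulrC t).
Qed.

Definition mix_pair (t : std_simplex R 1) (D E : 'rV[R]_d * R) : 'rV[R]_d * R :=
  (set_val t 0 ord0 *: D.1 + set_val t 0 ord_max *: E.1,
   set_val t 0 ord0 * D.2 + set_val t 0 ord_max * E.2).

(** Interpolating centers and radii interpolates the maps pointwise, so convexity of discs controls
    the moving disc. *)
Lemma mix_pairE t D E x : (mix_pair t D E).1 + (mix_pair t D E).2 *: x =
  set_val t 0 ord0 *: (D.1 + D.2 *: x) +
  set_val t 0 ord_max *: (E.1 + E.2 *: x).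
Proof. by rewrite /= scalerDl !scalerDr !scalerA addrACA. Qed.

Lemma mix_little_discs t D E :
  little_discs D -> little_discs E -> little_discs (mix_pair t D E).
Proof.
have [t0 t1 t01] := std_simplex1P t.
move=> [D0 Dsub] [E0 Esub]; split=> [|x x1].
  rewrite /=; have [s_eq0|s_neq0] := eqVneq (set_val t 0 ord0) 0.
    by rewrite s_eq0 in t01 *; nra.
  have s_gt0 : 0 < set_val t 0 ord0 by rewrite lt_neqAle eq_sym s_neq0.
  by nra.
rewrite mix_pairE; apply: unit_disc_convex => //; [exact: Dsub|exact: Esub].
Qed.

Definition mix t (D E : little_discs) : little_discs :=
  SigSub (mem_set (mix_little_discs t (set_mem (valP D)) (set_mem (valP E)))).

Lemma mix_id t D : mix t D D = D.
Proof.
have [_ _ t1] := std_simplex1P t.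
apply: val_inj; rewrite /= /mix_pair -scalerDl -mulrDl t1 scale1r mul1r.
by rewrite -surjective_pairing.
Qed.

Lemma mix_start (t : std_simplex R 1) D E :
  set_val t 0 ord_max = 0 -> mix t D E = D.
Proof.
have [_ _ t1] := std_simplex1P t; move=> t0; rewrite t0 addr0 in t1.
apply: val_inj; rewrite /= /mix_pair t0 t1 !scale1r !scale0r !mul1r !mul0r !addr0.
by rewrite -surjective_pairing.
Qed.

Lemma mix_end (t : std_simplex R 1) D E : set_val t 0 ord0 = 0 -> mix t D E = E.
Proof.
have [_ _ t1] := std_simplex1P t; move=> t0; rewrite t0 add0r in t1.
apply: val_inj; rewrite /= /mix_pair t0 t1 !scale1r !scale0r !mul1r !mul0r !add0r.
by rewrite -surjective_pairing.
Qed.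

Lemma continuous_to_ptws (I : Type) (X Y : topologicalType)
    (f : X -> {ptws I -> Y}) :
  (forall i, continuous (fun x => f x i)) -> continuous f.
Proof.
move=> cf x; apply/cvg_sup => i; move: x.
by apply: (@continuous_comp_initial _ X Y (fun g : I -> Y => g i) f); exact: cf.
Qed.

Lemma continuous_to_set (X Y : topologicalType) (A : set Y) (f : X -> A) :
  continuous (fun x => set_val (f x)) -> continuous f.
Proof. by move=> cf; apply: continuous_comp_initial. Qed.

Lemma continuous_discs_coord k n (i : 'I_n) :
  continuous (fun D : discs_space R d k n => set_val D i).
Proof.
apply: (@continuous_compose _ {ptws 'I_n -> little_discs} _ set_val
  (fun D => D i)).
  exact: continuous_val.
exact: (@proj_continuous _ (fun=> little_discs) i).
Qed.

Lemma continuous_to_little_discs (X : topologicalType) (f : X -> little_discs) :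
  (forall j, continuous (fun x => (set_val (f x)).1 0 j)) ->
  continuous (fun x => (set_val (f x)).2) -> continuous f.
Proof.
move=> cf1 cf2; apply: continuous_to_set.
rewrite (_ : (fun _ => _) = (fun x => ((set_val (f x)).1, (set_val (f x)).2))).
  by apply: continuous_pair => //; apply: continuous_to_rV.
by apply/funext => x; rewrite -surjective_pairing.
Qed.

Lemma continuous_radius : continuous (fun D : little_discs => (set_val D).2).
Proof.
apply: (@continuous_compose _ _ _ set_val snd); first exact: continuous_val.
by move=> x; exact: cvg_snd.
Qed.

Lemma continuous_center j :
  continuous (fun D : little_discs => (set_val D).1 0 j).
Proof.
apply: (@continuous_compose _ 'rV[R]_d _ (fun D : little_discs => (set_val D).1)
  (fun c => c 0 j)); last exact: coord_continuous.
apply: (@continuous_compose _ _ _ set_val fst); first exact: continuous_val.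
by move=> x; exact: cvg_fst.
Qed.

Lemma continuous_combination (X : topologicalType) (s u t v : X -> R) :
  continuous s -> continuous u -> continuous t -> continuous v ->
  continuous (fun x => s x * u x + t x * v x).
Proof.
move=> cs cu ct cv x.
exact: continuousD (continuousM (cs x) (cu x)) (continuousM (ct x) (cv x)).
Qed.

Lemma continuous_mix (X : topologicalType) (T : X -> std_simplex R 1)
    (D E : X -> little_discs) :
  continuous T -> continuous D -> continuous E ->
  continuous (fun x => mix (T x) (D x) (E x)).
Proof.
move=> cT cD cE.
have cT0 i : continuous (fun x => set_val (T x) 0 i).
  exact: (continuous_compose cT (@continuous_coord R 1 i)).
apply: continuous_to_little_discs => [j|].
  rewrite (_ : (fun _ => _) = (fun x : X =>
    set_val (T x) 0 ord0 * (set_val (D x)).1 0 j +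
    set_val (T x) 0 ord_max * (set_val (E x)).1 0 j)); last first.
    by apply/funext => y; rewrite !mxE.
  apply: continuous_combination => //.
    exact: (continuous_compose cD (@continuous_center j)).
  exact: (continuous_compose cE (@continuous_center j)).
apply: continuous_combination => //.
  exact: (continuous_compose cD continuous_radius).
exact: (continuous_compose cE continuous_radius).
Qed.

(** Convexity of the unit disc keeps each moving disc inside it; the hypothesis says that the
    configuration stays in the space. *)
Lemma straight_line_homology_map (X : topologicalType) k n
    (f g : continuousType X (discs_space R d k n)) :
  (forall x t, @nonoverlapping R d k n
    (fun i => mix t (set_val (f x) i) (set_val (g x) i))) ->
  forall m (a : homology R m X), homology_map f a = homology_map g a.
Proof.
move=> fgP.
pose H (xt : (X * std_simplex R 1)%type) : discs_space R d k n :=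
  SigSub (mem_set (fgP xt.1 xt.2)).
have cH : continuous H.
  apply: continuous_to_set; apply: continuous_to_ptws => i.
  apply: continuous_mix; first by move=> x; exact: cvg_snd.
  - apply: (@continuous_compose _ _ _ (fun x => f x.1) (fun D => set_val D i)).
      apply: (@continuous_compose _ _ _ fst f); last exact: cts_fun.
      by move=> x; exact: cvg_fst.
    exact: continuous_discs_coord.
  - apply: (@continuous_compose _ _ _ (fun x => g x.1) (fun D => set_val D i)).
      apply: (@continuous_compose _ _ _ fst g); last exact: cts_fun.
      by move=> x; exact: cvg_fst.
    exact: continuous_discs_coord.
apply: (@homotopy_homology_map R X _ f g (mkcts cH)) => x t t0;
  apply: val_inj; apply/funext => i; rewrite /= /mkcts /=.
  exact: mix_start.
exact: mix_end.
Qed.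

End MovingDiscs.

(** * Halved discs, slots, and configurations with one moving disc *)

Section Staging.
Context (R : realType) (d : nat).
Local Notation unit_disc := (@unit_disc R d.+1).
Local Notation little_discs := (@little_discs R d.+1).
Local Notation nonoverlapping k n := (@Defs.nonoverlapping R d.+1 k n).
Local Notation e0 := (delta_mx 0 0 : 'rV[R]_d.+1).

(** The triangle inequality [|a e0 + r x| < a + r], proved on squares. *)
Lemma unit_disc_axis a r x : 0 <= a -> 0 < r -> a + r <= 1 ->
  unit_disc x -> unit_disc (a *: e0 + r *: x).
Proof.
move=> a0 r0 ar x1; have /andP[_ x0] := unit_disc_coord ord0 x1.
move: x1; rewrite /Defs.unit_disc /= !big_ord_recl !mxE eqxx /= mulr1 => x1.
under eq_bigr do rewrite !mxE /= mulr0 add0r exprMn.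
rewrite -mulr_sumr; set S := \sum_(i < d) _ in x1 *.
have r2 : r ^+ 2 * (x 0 ord0 ^+ 2 + S) < r ^+ 2 * 1.
  by rewrite ltr_pM2l ?exprn_gt0.
have axr : a * r * x 0 ord0 <= a * r.
  by apply: ler_piMr; [rewrite mulr_ge0 // ltW|exact: ltW].
have ar2 : (a + r) ^+ 2 <= 1 by rewrite expr_le1 // addr_ge0 // ltW.
by lra.
Qed.

Lemma half_little_discs (D : little_discs) :
  @Defs.little_discs R d.+1 (2^-1 *: (val D).1, 2^-1 * (val D).2).
Proof.
split=> [|x x1] /=; first by rewrite mulr_gt0 ?invr_gt0 ?little_discs_radius.
have Dx : disc D ((val D).1 + (val D).2 *: x) by exists x.
have := disc_unit_disc Dx; rewrite -scalerA -scalerDr.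
rewrite /Defs.unit_disc /=; under [in X in _ -> X]eq_bigr do rewrite mxE exprMn.
by rewrite -mulr_sumr; lra.
Qed.

(** Scaling is about the origin, not about the center of [D]. *)
Definition half_disc (D : little_discs) : little_discs :=
  SigSub (mem_set (half_little_discs D)).

Lemma continuous_half : continuous half_disc.
Proof.
apply: continuous_to_little_discs => [j|].
  (* The summand [0 * 0] gives the shape required by [continuous_combination]. *)
  rewrite (_ : (fun _ => _) = (fun D : little_discs =>
    2^-1 * (set_val D).1 0 j + 0 * 0)); last first.
    by apply/funext => D; rewrite !mxE mul0r addr0.
  by apply: continuous_combination; try exact: cst_continuous;
    exact: continuous_center.
rewrite (_ : (fun _ => _) = (fun D : little_discs =>
    2^-1 * (set_val D).2 + 0 * 0)); last first.
  by apply/funext => D; rewrite mul0r addr0.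
by apply: continuous_combination; try exact: cst_continuous;
  exact: continuous_radius.
Qed.

Lemma disc_half D p : disc (half_disc D) p -> disc D (2 *: p).
Proof.
move=> [x x1 <-]; exists x => //.
by rewrite /= -scalerA -scalerDr scalerA divff ?scale1r ?pnatr_eq0.
Qed.

Lemma half_coord D p : disc (half_disc D) p -> p 0 0 < 2^-1.
Proof.
move=> /disc_half/disc_unit_disc/(unit_disc_coord 0).
rewrite mxE => /andP[_ p1]; lra.
Qed.

(** The partly halved disc is [D] scaled by a positive factor that depends on [t] alone. A common
    point of several such discs therefore rescales to a common point of the original ones. *)
Lemma disc_mix_half t D p : disc (mix t D (half_disc D)) p ->
  disc D ((set_val t 0 ord0 + set_val t 0 ord_max * 2^-1)^-1 *: p).
Proof.
have [t0 t1 t01] := std_simplex1P t.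
move=> [x x1 <-]; rewrite mix_pairE /= -scalerA -scalerDr scalerA -scalerDl.
set c := _ + _; have c0 : 0 < c by rewrite /c; lra.
by rewrite scalerA mulVf ?gt_eqF // scale1r; exists x.
Qed.

(** Then [n] slots of diameter [1 / (2 n)] fit side by side on the first axis between 1/2 and 1. *)
Definition slot_radius n : R := (4 * n%:R)^-1.

Lemma base_little_discs n (i : 'I_n) : @Defs.little_discs R d.+1
  ((2^-1 + (2 * i%:R + 1) * slot_radius n) *: e0, slot_radius n).
Proof.
have n0 : 0 < n%:R :> R by rewrite ltr0n; case: n i => [[]|].
have r0 : 0 < slot_radius n by rewrite invr_gt0 mulr_gt0.
have i0 : 0 <= i%:R :> R by [].
split=> //= x; apply: unit_disc_axis => //; first by nra.
have rn : slot_radius n * n%:R = 4^-1.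
  by rewrite /slot_radius invfM mulrAC -mulrA mulfV ?mulr1 ?gt_eqF.
have : i%:R + 1 <= n%:R :> R by rewrite natr1 ler_nat.
by nra.
Qed.

Definition base_disc n (i : 'I_n) : little_discs :=
  SigSub (mem_set (base_little_discs i)).

Lemma base_disc_coord n (i : 'I_n) p : disc (base_disc i) p ->
  2^-1 + 2 * i%:R * slot_radius n < p 0 0 < 2^-1 + 2 * i.+1%:R * slot_radius n.
Proof.
move=> [x /(unit_disc_coord 0) x1 <-]; rewrite !mxE /= mulr1.
have n0 : 0 < n%:R :> R by rewrite ltr0n; case: n i => [[]|].
have r0 : 0 < slot_radius n by rewrite invr_gt0 mulr_gt0.
by rewrite -natr1; move: x1 => /andP[]; nra.
Qed.

Lemma base_disc_gt_half n (i : 'I_n) p : disc (base_disc i) p -> 2^-1 < p 0 0.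
Proof.
move=> /base_disc_coord/andP[+ _]; apply: le_lt_trans.
by rewrite lerDl !mulr_ge0 // invr_ge0 mulr_ge0.
Qed.

Lemma base_disc_disjoint n (i j : 'I_n) p : (i < j)%N ->
  disc (base_disc i) p -> ~ disc (base_disc j) p.
Proof.
move=> ij /base_disc_coord/andP[_ pi] /base_disc_coord/andP[pj _].
have r0 : 0 <= slot_radius n by rewrite invr_ge0 mulr_ge0.
have le_ij : i.+1%:R <= j%:R :> R by rewrite ler_nat.
by have := ler_wpM2r r0 le_ij; lra.
Qed.

Lemma nonoverlapping_ge k k' n : (k <= k')%N ->
  nonoverlapping k n `<=` nonoverlapping k' n.
Proof.
move=> /subnK <-; elim: (k' - k)%N => [//|l IH] D /IH.
exact: nonoverlappingS.
Qed.

Lemma nonoverlapping_disjoint k n (E : 'I_n -> little_discs) : (2 <= k)%N ->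
  (forall (i j : 'I_n) p, (i < j)%N -> disc (E i) p -> ~ disc (E j) p) ->
  nonoverlapping k n E.
Proof.
move=> k2 Edisj; apply: (nonoverlapping_ge k2) => J cardJ [p Jp].
have /card_gt1P[i [j [iJ jJ ij]]] : (1 < #|J|)%N by rewrite cardJ.
have [lt_ij|lt_ji|/val_inj eq_ij] := ltngtP i j.
- exact: Edisj lt_ij (Jp i iJ) (Jp j jJ).
- exact: Edisj lt_ji (Jp j jJ) (Jp i iJ).
- by rewrite eq_ij eqxx in ij.
Qed.

(* The disc [E j] is arbitrary: it can only increase multiplicities by one. *)
Lemma nonoverlapping_moving k n (D E : 'I_n -> little_discs) (j : nat) :
  (2 <= k)%N -> nonoverlapping k n D ->
  (forall i : 'I_n, (i < j)%N -> E i = base_disc i) ->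
  (forall i : 'I_n, (j < i)%N -> E i = half_disc (D i)) ->
  nonoverlapping k.+1 n E.
Proof.
move=> k2 Dk Elt Egt J cardJ [p Jp].
(* Removing the moving index from the [k + 1] indices of [J] leaves at least [k]. *)
pose K := [set i in J | i != j :> nat]%SET.
have cardK : (k <= #|K|)%N.
  rewrite -ltnS -cardJ -(cardsID [set i : 'I_n | i == j :> nat]%SET J).
  rewrite -addn1 addnC leq_add //.
    by apply: subset_leq_card; apply/fintype.subsetP => i; rewrite !inE andbC.
  apply/card_le1_eqP => a b; rewrite !inE => /andP[_ /eqP aj] /andP[_ /eqP bj].
  by apply: val_inj; rewrite /= aj bj.
have inK i : i \in K -> i \in J /\ i != j :> nat by rewrite !inE => /andP[].
(* If some disc of [K] is in its slot, then, as [K] has at least two elements, another resting disc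
   meets it at [p]. That disc is in a different slot, or halved and so on the other side of
   [x_0 = 1/2]. *)
have [/existsP[i /andP[iK ij]]|/existsPn Kgt] :=
    boolP [exists i, (i \in K) && (i < j)%N].
  have [iJ _] := inK i iK.
  have pi := Jp i iJ; rewrite (Elt i ij) in pi.
  have /card_gt1P[a [b [aK bK ab]]] : (1 < #|K|)%N by apply: leq_trans cardK.
  have [l lK li] : exists2 l, l \in K & l != i.
    by have [ai|ai] := eqVneq a i; [exists b; rewrite // -ai eq_sym|exists a].
  have [lJ lj] := inK l lK; have := Jp l lJ.
  have [lt_lj|lt_jl|eq_lj] := ltngtP l j; last by rewrite eq_lj eqxx in lj.
    rewrite (Elt l lt_lj) => pl.
    have [lt_il|lt_li|/val_inj eq_li] := ltngtP i l.
    - exact: base_disc_disjoint lt_il pi pl.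
    - exact: base_disc_disjoint lt_li pl pi.
    - by rewrite eq_li eqxx in li.
  rewrite (Egt l lt_jl) => /half_coord p1; have := base_disc_gt_half pi; lra.
(* Otherwise all discs of [K] are halved, and doubling [p] gives a common point of at least [k]
   original discs. *)
apply: (nonoverlapping_ge cardK Dk (J := K)) => //; exists (2 *: p) => i iK.
have [iJ ij] := inK i iK; apply: disc_half; rewrite -Egt; first exact: Jp.
have := Kgt i; rewrite iK /= -leqNgt => ji.
by rewrite ltn_neqAle eq_sym ij.
Qed.

End Staging.

(** * The null-homotopy and path-connectedness *)

Section NullHomotopy.
Context (R : realType) (d k n : nat) (k2 : (2 <= k)%N).
Local Notation X := (discs_space R d.+1 k n).
Local Notation Y := (discs_space R d.+1 k.+1 n).
Local Notation e0 := (delta_mx 0 0 : 'rV[R]_d.+1).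

Definition stage j (D : X) : {ptws 'I_n -> @little_discs R d.+1} :=
  fun i => if (i < j)%N then @base_disc R d n i else half_disc (set_val D i).

Lemma stage_nonoverlapping j (D : X) :
  @nonoverlapping R d.+1 k.+1 n (stage j D).
Proof.
apply: (@nonoverlapping_moving R d k n (set_val D) _ j) => //.
- exact: set_mem (valP D).
- by move=> i ij; rewrite /stage ij.
- by move=> i ji; rewrite /stage ltnNge ltnW.
Qed.

Definition stage_map j (D : X) : Y :=
  SigSub (mem_set (@stage_nonoverlapping j D)).

Lemma stage_mapE j (D : X) i : set_val (stage_map j D) i = stage j D i.
Proof. by []. Qed.

Lemma continuous_stage_map j : continuous (stage_map j).
Proof.
apply: continuous_to_set; apply: (@continuous_to_ptws _ _ _ (stage j)) => i.
rewrite /= /stage; case: ltnP => _; first exact: cst_continuous.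
apply: (@continuous_compose _ _ _ (fun D : X => set_val D i) (@half_disc R d)).
  exact: continuous_discs_coord.
exact: continuous_half.
Qed.
HB.instance Definition _ j :=
  @isContinuous.Build X Y (stage_map j) (@continuous_stage_map j).

(** At each time all discs are scaled by one common factor, so no overlap is created. *)
Lemma homology_map_stage0 m (a : homology R m X) :
  homology_map (discs_incl R d.+1 k n) a = homology_map (stage_map 0) a.
Proof.
apply: straight_line_homology_map => D t J cardJ [p Jp].
apply: (nonoverlapping_ge (leqnSn k) (set_mem (valP D)) cardJ).
exists ((set_val t 0 ord0 + set_val t 0 ord_max * 2^-1)^-1 *: p) => i iJ.
have := Jp i iJ; exact: disc_mix_half.
Qed.

(** At most disc [j] moves between the two stages, so [nonoverlapping_moving] applies at every
    time. *)
Lemma homology_map_stageS j m (a : homology R m X) :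
  homology_map (stage_map j) a = homology_map (stage_map j.+1) a.
Proof.
apply: straight_line_homology_map => D t.
apply: (@nonoverlapping_moving R d k n (set_val D) _ j) => //.
- exact: set_mem (valP D).
- by move=> i ij; rewrite !stage_mapE /stage ij ltnS ltnW // mix_id.
- by move=> i ji; rewrite !stage_mapE /stage ltnS [(i <= j)%N]leqNgt ji ltnNge
    (ltnW ji) /= mix_id.
Qed.

Lemma base_nonoverlapping : @nonoverlapping R d.+1 k.+1 n (@base_disc R d n).
Proof.
by apply: nonoverlapping_disjoint => [|i j p];
  [rewrite ltnW|exact: base_disc_disjoint].
Qed.

Definition base_config : Y := SigSub (mem_set base_nonoverlapping).

Lemma homology_map_discs_incl m (a : homology R m X) :
  homology_map (discs_incl R d.+1 k n) a =
  homology_map (cst base_config : continuousType X Y) a.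
Proof.
rewrite homology_map_stage0.
have stageE j : homology_map (stage_map 0) a = homology_map (stage_map j) a.
  by elim: j => [|j ->] //; rewrite homology_map_stageS.
(* At stage [n] every disc is in its slot, so the map is constant. *)
rewrite (stageE n).
apply: eq_homology_map => D; apply: val_inj; apply/funext => i.
by rewrite [LHS]stage_mapE /stage ltn_ord.
Qed.

(* Only the first coordinate matters: discs whose centers share it are pulled
   apart by the shift [s * i], and the others are further apart than all shifts. *)
Lemma separating_perturbation (D : 'I_n -> @little_discs R d.+1) :
  exists E : 'I_n -> @little_discs R d.+1,
    (forall (i j : 'I_n) p, (i < j)%N -> disc (E i) p -> ~ disc (E j) p) /\
    (forall i p, disc (E i) p -> disc (D i) p).
Proof.
pose c i := (val (D i)).1 0 0.
(* These are finitely many positive upper bounds on [s], so any small enough positive [s] meets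
   them. *)
have [s [s0 sr sc]] : exists s : R, [/\ 0 < s,
    forall i, s * n.+1%:R < (val (D i)).2 &
    forall i j, c i != c j -> s * n.+1%:R < `|c i - c j|].
  have small (e : R) : 0 < e -> \forall s \near 0^'+, s * n.+1%:R < e.
    move=> e0; near=> s; rewrite -ltr_pdivlMr ?ltr0n //; near: s.
    by apply: nbhs_right_lt; rewrite divr_gt0.
  have smallr : \forall s \near 0^'+, forall i, s * n.+1%:R < (val (D i)).2.
    by apply: filter_forall => i; apply: small; exact: little_discs_radius.
  have smallc : \forall s \near 0^'+, forall i j,
      c i != c j -> s * n.+1%:R < `|c i - c j|.
    apply: filter_forall => i; apply: filter_forall => j.
    have [->|cij] := eqVneq (c i) (c j); first by near=> s.
    have : 0 < `|c i - c j| by rewrite normr_gt0 subr_eq0.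
    by move=> /small; apply: filterS.
  near (0 : R)^'+ => s; exists s; split; near: s => //.
  exact: nbhs_right_gt.
have in_le (i : 'I_n) : i%:R + 1 <= n%:R :> R by rewrite natr1 ler_nat.
(* The new disc has radius [s / 3] and its center is shifted by [s i]; it stays in [D i] because
   [s i + s / 3 < s (n + 1)], which is below the old radius. *)
have Esub (i : 'I_n) x : unit_disc x ->
    disc (D i) ((val (D i)).1 + (s * i%:R) *: e0 + (s / 3) *: x).
  move=> x1; set r := (val (D i)).2.
  have r0 : 0 < r := little_discs_radius (D i).
  exists (((s * i%:R) / r) *: e0 + ((s / 3) / r) *: x).
    apply: unit_disc_axis => //.
    - apply: divr_ge0; last exact: ltW.
      by apply: mulr_ge0 => //; exact: ltW.
    - by rewrite !divr_gt0.
    - rewrite -mulrDl ler_pdivrMr // mul1r.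
      by have := sr i; have := in_le i; rewrite -/r -natr1; nra.
  by rewrite scalerDr !scalerA ![r * _]mulrC !divfK ?gt_eqF // addrA.
have E_little i :
    @little_discs R d.+1 ((val (D i)).1 + (s * i%:R) *: e0, s / 3).
  by split=> [|x x1] /=; [rewrite divr_gt0|exact: disc_unit_disc (Esub i x x1)].
exists (fun i => SigSub (mem_set (E_little i))); split; last first.
  by move=> i p [x x1 <-]; exact: Esub.
move=> i j p ij [x /(unit_disc_coord 0)/andP[x1 x2] <-].
move=> [y /(unit_disc_coord 0)/andP[y1 y2] /matrixP/(_ 0 0)].
rewrite !mxE /= !mulr1 -/(c i) -/(c j).
have ij1 : i%:R + 1 <= j%:R :> R by rewrite natr1 ler_nat.
(* With equal first coordinates the new centers are at least [s] apart, more than the sum [2 s / 3]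
   of the radii. Otherwise the old gap exceeds [s (n + 1)], while shifts and radii account for at
   most [s (n - 1) + 2 s / 3]. *)
have [->|/sc] := eqVneq (c i) (c j); first by nra.
have := in_le j; have : 0 <= i%:R :> R by [].
by move=> i0 jn; rewrite ltr_normr -natr1 => /orP[]; nra.
Unshelve. all: by end_near.
Qed.

Lemma homology_map_cst_config (D : Y) m (a : homology R m Defs.point) :
  homology_map (cst D : continuousType Defs.point Y) a =
  homology_map (cst base_config : continuousType Defs.point Y) a.
Proof.
have [E [Edisj Esub]] := separating_perturbation (set_val D).
have EX : @nonoverlapping R d.+1 k n E by apply: nonoverlapping_disjoint.
pose E' : X := SigSub (mem_set EX).
(* The path from [D] to [E'] keeps each disc inside the old one. The constant map at [E'] factors
   through the inclusion, which is already known to be constant in homology. *)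
transitivity (homology_map (discs_incl R d.+1 k n)
  (homology_map (cst E' : continuousType Defs.point X) a)).
  rewrite -homology_map_comp; apply: straight_line_homology_map => u t J cardJ.
  have DY : @nonoverlapping R d.+1 k.+1 n (set_val D) := set_mem (valP D).
  move=> [p Jp]; apply: (DY J cardJ); exists p => i /Jp.
  have [t0 t1 t01] := std_simplex1P t.
  move=> [x x1 <-]; rewrite mix_pairE; apply: disc_convex => //.
    by exists x.
  by apply: Esub; exists x.
by rewrite homology_map_discs_incl -homology_map_comp; exact: eq_homology_map.
Qed.

End NullHomotopy.

(* The first two conditions say that [iota] is the inclusion of [H_0], identified
   with [com] by [to_com] (in positive degrees [com] is zero). *)
Theorem corollary2p2 (R : realType) (d : nat) (hd : (1 <= d)%N)
    (k : nat) (hk : (2 <= k)%N) :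
  exists iota : forall n m : nat,
      {additive com n m -> homology R m (discs_space R d k.+1 n)},
    [/\ forall n m : nat, cancel (iota n m) (@to_com R n m _),
        forall n : nat, cancel (@to_com R n 0 _) (iota n 0%N) &
        forall (n m : nat) (a : homology R m (discs_space R d k n)),
          homology_map (discs_incl R d k n) a = iota n m (to_com n a)].
Proof.
(* Writing the dimension as a successor provides the first coordinate, along which the slots lie. *)
case: d hd => // d _.
exists (fun n m => @com_at R _ (base_config R d n hk) n m).
split=> [n m|n|n m a].
- exact: com_atK.
- by apply: to_comK => D a; exact: homology_map_cst_config.
- by rewrite /= com_at_to_com homology_map_discs_incl.
Qed.
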